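(* For any integer $n>1$, we have $$\sum_{k=0}^{n-1} (9k^2 + 5k) (-1)^k f_k \equiv 0 \pmod{n^2(n-1)}.$$ Moreover, for any odd prime $p$ we have $$\sum_{k=0}^{p-1} (9k^2 + 5k) (-1)^k f_k \equiv 3p^2(p-1)-16p^3q_p(2) \pmod{p^4},$$ where $q_p(2)$ denotes the Fermat quotient $(2^{p-1}-1)/p$.
   Context: The Franel numbers are $f_k:=\sum_{l=0}^k\binom{k}{l}^3$ for $k=0,1,2,\ldots$. *)

(* Defs.v *)
From mathcomp Require Import all_boot all_order all_algebra.

Set Implicit Arguments.
Unset Strict Implicit.
Unset Printing Implicit Defensive.

Import GRing.Theory Num.Theory.
Local Open Scope ring_scope.

Definition franel (k : nat) : nat := (\sum_(0 <= l < k.+1) 'C(k, l) ^ 3)%N.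

(* The division is exact when p is prime and p does not divide a
   (Fermat's little theorem), so this is the rational (a^(p-1) - 1) / p. *)
Definition fermat_quotient (p : nat) (a : int) : int :=
  ((a ^+ p.-1 - 1) %/ p%:Z)%Z.

Definition franel_sum (n : nat) : int :=
  \sum_(0 <= k < n)
    (9 * k%:Z ^+ 2 + 5 * k%:Z) * (-1) ^+ k * (franel k)%:Z.

(* Main.v *)
(** Write F_k = (-1)^k f_k.  Franel's three-term recurrence (proved with a
    Zeilberger certificate) makes the sum telescope:
      6 S_n = (-1)^n n^2 ((3n - 7) f_n - (24n - 32) f_(n-1)).
    For the divisibility, with m = n - 1, cubing Pascal's rule gives
      f_n = 2 f_m + 3 \sum_k C(m,k) C(m,k-1) C(m+1,k),
    where modulo m every term is killed by both k and m + 1 - k, hence by their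
    sum m + 1 = 1, so m divides it.  For a prime p, f_p = 2 modulo p^2, and
    x = C(p-1,k) satisfies (x - (-1)^k)^2 = 0 modulo p^2, so that
    x^3 = 3 x - 2 (-1)^k and f_(p-1) = 3 * 2^(p-1) - 2 modulo p^2. *)
Require Import Defs.
From mathcomp Require Import all_boot all_order all_algebra.
From mathcomp Require Import cyclic zify ring.

Import GRing.Theory Num.Theory.
Local Open Scope ring_scope.

Lemma PoszX (m k : nat) : (m ^ k)%N%:Z = m%:Z ^+ k.
Proof. by elim: k => // k IHk; rewrite expnS exprS PoszM IHk. Qed.

(** The added binomials vanish, so Franel numbers of different index can be summed over one common
    range. *)
Lemma franelE (N n : nat) : (n < N)%N ->
  (franel n)%:Z = \sum_(0 <= k < N) ('C(n, k)%:Z) ^+ 3.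
Proof.
move=> ltnN; rewrite (@big_cat_nat _ _ _ n.+1) //=.
rewrite [X in _ = _ + X]big_nat [X in _ = _ + X]big1.
  rewrite addr0 /franel (big_morph Posz PoszD (erefl _)).
  by apply: eq_bigr => k _; rewrite -PoszX.
by move=> k /andP[ltnk _]; rewrite bin_small.
Qed.

Lemma mulz_bin_succ (n k : nat) :
  (k%:Z + 1) * 'C(n, k.+1)%:Z = (n%:Z - k%:Z) * 'C(n, k)%:Z.
Proof.
have [lekn | ltnk] := leqP k n; last first.
  by rewrite !bin_small ?ltnS ?mulr0 // ltnW.
by rewrite subzn // -PoszM -mul_bin_left PoszM -[k.+1]addn1 PoszD.
Qed.

Lemma mulz_bin_down (n k : nat) :
  (n%:Z + 1 - k%:Z) * 'C(n.+1, k)%:Z = (n%:Z + 1) * 'C(n, k)%:Z.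
Proof.
have [lekn | ltnk] := leqP k n.+1; last first.
  by rewrite !bin_small ?mulr0 // ltnW.
have -> : n%:Z + 1 - k%:Z = (n.+1 - k)%N by lia.
by rewrite -PoszM -mul_bin_down PoszM -{1}[n.+1]addn1 PoszD.
Qed.

(* The coefficients of the cubic solve
   [(n+2-k)^3 q(n,k+1) - k^3 q(n,k) = (n+2)^5 (n+1)
     - (7 (n+1)^2 + 7 (n+1) + 2) (n+1) (n+2-k)^3 - 8 ((n+2-k) (n+1-k))^3],
   whose right-hand side is the summand of [franel_rec] divided by
   'C(n.+2, k) ^ 3 and multiplied by (n+2)^3 (n+1). *)
Definition franel_cert (n k : int) : int :=
  4 * k ^+ 3 - (18 * n + 30) * k ^+ 2 + (27 * n ^+ 2 + 93 * n + 78) * k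
  - (14 * n ^+ 3 + 74 * n ^+ 2 + 128 * n + 72).

Lemma franel_rec (n : nat) :
  (n%:Z + 2) ^+ 2 * (franel n.+2)%:Z =
    (7 * (n%:Z + 1) ^+ 2 + 7 * (n%:Z + 1) + 2) * (franel n.+1)%:Z
    + 8 * (n%:Z + 1) ^+ 2 * (franel n)%:Z.
Proof.
rewrite !(@franelE n.+3) //; last by lia.
rewrite !mulr_sumr -big_split /=.
pose N : int := n%:Z.
(* The factor [k ^+ 3] kills [G] at 0 and the binomial kills it at [n.+3], so the telescoped sum is
   zero. *)
pose G k := (N + 1) ^+ 2 * ('C(n.+2, k)%:Z * k%:Z) ^+ 3 * franel_cert N k%:Z.
have step (k : nat) : ((N + 2) * (N + 1)) ^+ 3 *
    ((N + 2) ^+ 2 * 'C(n.+2, k)%:Z ^+ 3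
     - ((7 * (N + 1) ^+ 2 + 7 * (N + 1) + 2) * 'C(n.+1, k)%:Z ^+ 3
        + 8 * (N + 1) ^+ 2 * 'C(n, k)%:Z ^+ 3)) = G k.+1 - G k.
  have up : 'C(n.+2, k.+1)%:Z * k.+1%:Z = (N + 2 - k%:Z) * 'C(n.+2, k)%:Z.
    by have := mulz_bin_succ n.+2 k; rewrite /N; lia.
  have d1 : (N + 2) * 'C(n.+1, k)%:Z = (N + 2 - k%:Z) * 'C(n.+2, k)%:Z.
    by have := mulz_bin_down n.+1 k; rewrite /N; lia.
  have d2 : (N + 2) * (N + 1) * 'C(n, k)%:Z =
      (N + 1 - k%:Z) * (N + 2 - k%:Z) * 'C(n.+2, k)%:Z.
    by rewrite -mulrA -mulz_bin_down mulrCA d1 mulrA.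
  rewrite /G up /franel_cert (_ : k.+1%:Z = k%:Z + 1); last by lia.
  transitivity ((N + 2) ^+ 5 * (N + 1) ^+ 3 * 'C(n.+2, k)%:Z ^+ 3
     - ((7 * (N + 1) ^+ 2 + 7 * (N + 1) + 2) * (N + 1) ^+ 3
          * ((N + 2) * 'C(n.+1, k)%:Z) ^+ 3
        + 8 * (N + 1) ^+ 2 * ((N + 2) * (N + 1) * 'C(n, k)%:Z) ^+ 3)).
    by ring.
  by rewrite d1 d2; ring.
have nz : ((N + 2) * (N + 1)) ^+ 3 != 0.
  by rewrite expf_neq0 // mulf_neq0 /N; lia.
apply/eqP; rewrite -subr_eq0 -sumrB -(mulrI_eq0 _ (mulfI nz)) mulr_sumr; apply/eqP.
rewrite (eq_bigr (fun k => G k.+1 - G k)) => [|k _]; last exact: step.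
by rewrite telescope_sumr // /G bin_small // !(exprS, mul0r, mulr0).
Qed.

Lemma franel_sum_closed (n : nat) :
  6 * franel_sum n.+1 = (-1) ^+ n.+1 * (n%:Z + 1) ^+ 2 *
    ((3 * n%:Z - 4) * (franel n.+1)%:Z - (24 * n%:Z - 8) * (franel n)%:Z).
Proof.
elim: n => [|n IHn].
  by rewrite /franel_sum /franel !big_nat_recr ?big_geq.
rewrite /franel_sum big_nat_recr //= -/(franel_sum n.+1) mulrDr IHn.
have rec := franel_rec n.
have -> : n.+1%:Z = n%:Z + 1 by lia.
rewrite [(-1) ^+ n.+2]exprS [(-1) ^+ n.+1]exprS; set s := (-1) ^+ n.
(* The right-hand side regrouped to isolate the left side of the recurrence. *)
transitivity (s * ((3 * n%:Z - 1) * ((n%:Z + 2) ^+ 2 * (franel n.+2)%:Z)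
   - (24 * n%:Z + 16) * (n%:Z + 2) ^+ 2 * (franel n.+1)%:Z)); last by ring.
by rewrite rec; ring.
Qed.

Lemma dvdz_bin3 (m k : nat) :
  (m%:Z %| 'C(m, k.+1)%:Z * 'C(m, k)%:Z * 'C(m.+1, k.+1)%:Z)%Z.
Proof.
case: m => [|m]; first by rewrite [X in Posz X]bin_small // !mul0r.
set T := _ * _.
have e1 : k.+1%:Z * 'C(m.+1, k.+1)%:Z = m.+1%:Z * 'C(m, k)%:Z.
  by rewrite -!PoszM -mul_bin_diag.
have e2 : (m.+1%:Z - k%:Z) * 'C(m.+1, k)%:Z = m.+1%:Z * 'C(m, k)%:Z.
  by have := mulz_bin_down m k; lia.
(* By [e1] and [e2], [(k+1) T] and [(m+1-k) T] are multiples of [m+1]. Their sum is [(m+2) T];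
   moving [(m+1) T] across leaves [T]. *)
have -> : T = ('C(m, k)%:Z * ('C(m.+1, k)%:Z + 'C(m.+1, k.+1)%:Z)
                 * 'C(m.+2, k.+1)%:Z - T) * m.+1%:Z.
  rewrite /T; set a := 'C(m.+1, k.+1)%:Z in e1 *.
  set b := 'C(m.+1, k)%:Z in e2 *; set c := 'C(m.+2, k.+1)%:Z.
  have -> : ('C(m, k)%:Z * (b + a) * c - a * b * c) * m.+1%:Z =
    (m.+1%:Z * 'C(m, k)%:Z * b + m.+1%:Z * 'C(m, k)%:Z * a
       - a * b * m.+1%:Z) * c by ring.
  rewrite -{1}e1 -e2 -[k.+1]addn1 PoszD; ring.
exact: dvdz_mull.
Qed.

Lemma franel_succ (m : nat) :
  (3 * m%:Z %| (franel m.+1)%:Z - 2 * (franel m)%:Z)%Z.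
Proof.
have -> : (franel m.+1)%:Z - 2 * (franel m)%:Z = 3 *
    \sum_(0 <= k < m.+1)
      'C(m, k.+1)%:Z * 'C(m, k)%:Z * 'C(m.+1, k.+1)%:Z.
  have ltm : (m < m.+2)%N by rewrite ltnW.
  have e1 := franelE _ _ (ltnSn m.+1); have e0 := franelE _ _ ltm.
  rewrite big_nat_recl // bin0 in e1; rewrite big_nat_recl // bin0 in e0.
  (* One copy is shifted to the terms ['C(m, k.+1)], the other keeps ['C(m, k)], matching the two
     parts of Pascal's rule. *)
  have -> : 2 * (franel m)%:Z = (franel m)%:Z + (franel m)%:Z by ring.
  rewrite e1 {1}e0 (@franelE m.+1 m) //.
  set A := \sum_(_ <= _ < _) _; set B := \sum_(_ <= _ < _) _.
  set C := \sum_(_ <= _ < _) _.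
  have -> : 1 ^+ 3 + A - (1 ^+ 3 + B + C) = A - B - C by ring.
  rewrite /A /B /C -!sumrB mulr_sumr; apply: eq_bigr => k _.
  by rewrite binS PoszD; ring.
rewrite dvdz_mul2l //; apply: rpred_sum => k _; exact: dvdz_bin3.
Qed.

(** Cubing preserves parity, so [franel n] has the parity of [2 ^ n]. This supplies the 2 needed to
    cancel 6 in [franel_sum_dvd]. *)
Lemma odd_franel (n : nat) : odd (franel n) = (n == 0%N).
Proof.
rewrite /franel (big_morph odd oddD (erefl _)).
under eq_bigr do rewrite oddX /=.
rewrite -(big_morph odd oddD (erefl _)) big_mkord.
have := expnDn 1 1 n; under eq_bigr do rewrite !exp1n !muln1.
by move=> <-; rewrite oddX orbF.
Qed.

Lemma franel_prime (p : nat) : prime p ->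
  (p%:Z ^+ 2 %| (franel p)%:Z - 2)%Z.
Proof.
move=> p_pr; rewrite (@franelE p.+1) // big_nat_recr //= binn.
rewrite -{1}(prednK (prime_gt0 p_pr)) big_nat_recl // bin0.
have -> x : 1 ^+ 3 + x + 1 ^+ 3 - 2 = x :> int by ring.
rewrite big_nat; apply: rpred_sum => k /andP[_ ltk].
have pC : (p%:Z %| 'C(p, k.+1)%:Z)%Z.
  by rewrite dvdzE /= prime_dvd_bin // ltnS /= -ltn_predRL.
by rewrite exprSr dvdz_mulr // dvdz_exp2r.
Qed.

(** Pascal's rule: consecutive entries of row [p.-1] add up to an inner entry of row [p], a multiple
    of [p]. *)
Lemma bin_pred_prime (p k : nat) : prime p -> (k < p)%N ->
  (p%:Z %| 'C(p.-1, k)%:Z - (-1) ^+ k)%Z.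
Proof.
move=> p_pr; have p_gt0 := prime_gt0 p_pr.
elim: k => [|k IHk] ltkp; first by rewrite bin0 subrr dvdz0.
have pC : (p%:Z %| 'C(p, k.+1)%:Z)%Z by rewrite dvdzE /= prime_dvd_bin.
have -> : 'C(p.-1, k.+1)%:Z - (-1) ^+ k.+1 =
    'C(p, k.+1)%:Z - ('C(p.-1, k)%:Z - (-1) ^+ k).
  by rewrite -{2}(prednK p_gt0) binS PoszD exprS; ring.
by rewrite rpredB // IHk // ltnW.
Qed.

Lemma franel_pred_prime (p : nat) : prime p -> odd p ->
  (p%:Z ^+ 2 %| (franel p.-1)%:Z - (3 * 2 ^+ p.-1 - 2))%Z.
Proof.
move=> p_pr p_odd; have p_gt0 := prime_gt0 p_pr.
have sum2 : 2 ^+ p.-1 = \sum_(0 <= k < p) 'C(p.-1, k)%:Z.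
  rewrite -[2]/(1 + 1) exprDn prednK // big_mkord.
  by apply: eq_bigr => k _; rewrite !expr1n mulr1 natz.
(* As [p] is odd, this spreads the constant 2 over the summands as [2 * (-1) ^+ k]. *)
have sum1 : 1 = \sum_(0 <= k < p) (-1 : int) ^+ k.
  rewrite big_mkord; have := subrX1 (-1 : int) p.
  by rewrite -signr_odd p_odd expr1; set S := \sum_(_ < _) _; lia.
rewrite (@franelE p) ?prednK // sum2.
have -> : 3 * (\sum_(0 <= k < p) 'C(p.-1, k)%:Z) - 2 =
    \sum_(0 <= k < p) (3 * 'C(p.-1, k)%:Z - 2 * (-1) ^+ k).
  by rewrite sumrB -!mulr_sumr -sum1 mulr1.
rewrite -sumrB.
rewrite big_nat; apply: rpred_sum => k /andP[_ ltk].
set x := _%:Z; set e := (-1) ^+ k.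
have e2 : e ^+ 2 = 1 by rewrite /e sqrr_sign.
have -> : x ^+ 3 - (3 * x - 2 * e) = (x + 2 * e) * (x - e) ^+ 2.
  have -> : (x + 2 * e) * (x - e) ^+ 2 = x ^+ 3 - 3 * x * e ^+ 2 + 2 * e * e ^+ 2.
    by ring.
  by rewrite e2; ring.
by rewrite dvdz_mull // dvdz_exp2r // bin_pred_prime.
Qed.

Lemma franel_sum_dvd (m : nat) : (0 < m)%N ->
  (m.+1%:Z ^+ 2 * m%:Z %| franel_sum m.+1)%Z.
Proof.
move=> m_gt0; have [W eW] := dvdzP (franel_succ m).
have ev : ~~ odd (franel m.+1) by rewrite odd_franel.
(* Since [franel m.+1] is even and equals [2 f_m + 3 m W], the product [m W] is even, though [W]
   alone need not be. *)
have [V eV] : exists V, m%:Z * W = 2 * V.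
  exists ((franel m.+1)./2%:Z - (franel m)%:Z - m%:Z * W).
  have := odd_double_half (franel m.+1); rewrite (negbTE ev); lia.
apply/dvdzP; exists ((-1) ^+ m.+1 * (- 3 * (franel m)%:Z + 3 * V - 2 * W)).
apply: (@mulfI _ 6) => //; rewrite franel_sum_closed.
have -> : (franel m.+1)%:Z = 2 * (franel m)%:Z + 3 * (m%:Z * W).
  by move: eW; lia.
have -> : m.+1%:Z = m%:Z + 1 by lia.
set s := (-1) ^+ _.
transitivity (s * (m%:Z + 1) ^+ 2 *
  (- 18 * m%:Z * (franel m)%:Z + 9 * m%:Z * (m%:Z * W) - 12 * m%:Z * W)).
  by ring.
by rewrite eV; ring.
Qed.

Lemma fermat_quotientM (p : nat) : prime p -> odd p ->
  fermat_quotient p 2 * p%:Z = 2 ^+ p.-1 - 1.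
Proof.
move=> p_pr p_odd; rewrite /fermat_quotient divzK //.
have pos : (0 < 2 ^ p.-1)%N by rewrite expn_gt0.
have -> : 2 ^+ p.-1 - 1 = (2 ^ p.-1 - 1)%N%:Z :> int by rewrite -subzn // PoszX.
rewrite dvdzE /= -eqn_mod_dvd // -(totient_prime p_pr).
by apply/eqP/Euler_exp_totient; rewrite coprime2n.
Qed.

Theorem theorem1p1 :
  (forall n : nat, (1 < n)%N ->
    (franel_sum n = 0 %[mod n%:Z ^+ 2 * (n%:Z - 1)])%Z)
  /\
  (forall p : nat, prime p -> odd p ->
    (franel_sum p =
       3 * p%:Z ^+ 2 * (p%:Z - 1) - 16 * p%:Z ^+ 3 * fermat_quotient p 2
       %[mod p%:Z ^+ 4])%Z).
Proof.
split=> [[|m] // m_gt0 | p p_pr p_odd].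
  apply/eqP; rewrite eqz_mod_dvd subr0.
  have -> : m.+1%:Z - 1 = m%:Z by lia.
  exact: franel_sum_dvd.
(* The closed form gives 6 times the sum, and 6 is not invertible modulo 81; this case is
   computed. *)
have [-> | p_neq3] := eqVneq p 3%N.
  by rewrite /franel_sum /franel unlock.
have cop6 : coprimez (p%:Z ^+ 4) 6.
  rewrite coprimezXl // coprimezE -[absz 6]/(2 * 3)%N coprimeMr coprimen2 p_odd.
  by rewrite prime_coprime // dvdn_prime2.
apply/eqP; rewrite eqz_mod_dvd -(Gauss_dvdzr _ cop6).
have [A eA] := dvdzP (franel_prime _ p_pr).
have [B eB] := dvdzP (franel_pred_prime _ p_pr p_odd).
have := fermat_quotientM _ p_pr p_odd; set q := fermat_quotient p 2 => eq.
have := franel_sum_closed p.-1.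
have -> : p.-1%:Z = p%:Z - 1 by have := prime_gt0 p_pr; lia.
rewrite prednK ?prime_gt0 // -signr_odd p_odd => closed.
rewrite mulrBr closed.
have -> : (franel p)%:Z = 2 + A * p%:Z ^+ 2 by rewrite -eA; ring.
have -> : (franel p.-1)%:Z = 1 + 3 * (q * p%:Z) + B * p%:Z ^+ 2.
  by rewrite -eB eq; ring.
(* The product [(24 p - 32) * 3 q p] yields [72 q p^2], kept in the quotient, and [-96 q p], which
   matches [-6 * 16 q p]. *)
apply/dvdzP; exists (- (3 * p%:Z - 7) * A + (24 * p%:Z - 32) * B + 72 * q).
by ring.
Qed.
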